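(* Let $1<D<1.116$ be given. Then there exists $n_0$ (depending on $D$) such that for every dimension $n\ge n_0$ there is an $o$-symmetric convex body $K$ in $\mathbb{R}^n$ (that is, $K=-K$) with illumination number $$\mathrm{i}(K)=N(K,\operatorname{int}K)\ \geq\ 0.05\, D^n,$$ for which $$\frac{1}{D}\mathbf{B}^n\subset K\subset \mathbf{B}^n .$$
   Context: A convex body in $\mathbb{R}^n$ is a compact convex set with non-empty interior. $\mathbf{B}^n$ denotes the closed Euclidean unit ball of $\mathbb{R}^n$ centered at the origin $o$, and $\mathbb{S}^{n-1}$ its boundary sphere. For sets $K,L\subset\mathbb{R}^n$, $N(K,L)$ denotes the translative covering number of $K$ by $L$: the minimum number of translates of $L$ whose union covers $K$. $\operatorname{int}K$ denotes the interior of $K$ and $\operatorname{bd}K$ its boundary. A direction $u\in\mathbb{S}^{n-1}$ illuminates $K$ at a boundary point $b\in\operatorname{bd}K$ if the ray $\{b+\lambda u : \lambda>0\}$ intersects $\operatorname{int}K$. The illumination number $\mathrm{i}(K)$ is the minimum number of directions such that each boundary point of $K$ is illuminated by at least one of them; it is a known fact that $\mathrm{i}(K)=N(K,\operatorname{int}K)$ for every convex body $K$. *)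

(* Defs.v *)
From HB Require Import structures.
From mathcomp Require Import all_boot all_order all_algebra.
From mathcomp Require Import all_classical all_reals all_analysis.

Set Implicit Arguments.
Unset Strict Implicit.
Unset Printing Implicit Defensive.

Import Order.TTheory GRing.Theory Num.Theory.
Import numFieldNormedType.Exports.

Local Open Scope classical_set_scope.
Local Open Scope ring_scope.

Section Euclidean.
Context {R : realType} {n : nat}.
Implicit Types (x u b : 'rV[R]_n) (K L A : set 'rV[R]_n).

(* The library norm on 'rV[R]_n is the sup norm; it induces the usual topology
   of R^n, so that interior, closure and compact are the Euclidean notions. *)
Definition enorm x : R := Num.sqrt (\sum_(i < n) x ord0 i ^+ 2).

Definition unit_ball : set 'rV[R]_n := [set x | enorm x <= 1].

Definition unit_sphere : set 'rV[R]_n := [set x | enorm x = 1].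

Definition boundary A : set 'rV[R]_n := closure A `\` interior A.

Definition convex_body K : Prop :=
  [/\ compact K, convex_set K & interior K !=set0].

Definition o_symmetric K : Prop := K = [set - x | x in K].

(* The least number of elements of a finite set of vectors satisfying P,
   and +oo if there is no such finite set. *)
Definition min_card (P : set (set 'rV[R]_n)) : \bar R :=
  ereal_inf [set (m%:R : R)%:E | m in
    [set m : nat | exists2 A : set 'rV[R]_n, (A #= `I_m)%card & P A]].

(* A translate t + L is represented by its translation vector t. *)
Definition covering_number K L : \bar R :=
  min_card [set T | K `<=` \bigcup_(t in T) [set t + x | x in L]].

Definition illuminates u K b : Prop :=
  exists2 lambda : R, 0 < lambda & interior K (b + lambda *: u).

Definition illumination_number K : \bar R :=
  min_card [set U | U `<=` unit_sphere /\
    forall b, boundary K b -> exists2 u, U u & illuminates u K b].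

End Euclidean.

Arguments unit_ball : clear implicits.
Arguments unit_sphere : clear implicits.

(* Main.v *)
Require Import Defs.
From HB Require Import structures.
From mathcomp Require Import all_boot all_order all_algebra.
From mathcomp Require Import all_classical all_reals all_analysis.
From mathcomp Require Import ring lra zify.
Import Order.TTheory GRing.Theory Num.Theory.
Import numFieldNormedType.Exports.
Local Open Scope classical_set_scope.
Local Open Scope ring_scope.

Set Implicit Arguments.
Unset Strict Implicit.
Unset Printing Implicit Defensive.

(** A ball with spikes.  Put [t = sqrt (1 - D^-2)], so that the smallest convex
    cone with apex at a unit vector [x] containing the ball of radius [1 / D]
    consists of the [y] with [t * |y - x| <= <x - y, x>].  For a set [Y] of unit
    vectors, let [K] be the part of the unit ball lying in the cones of all [x]
    and [- x], [x] in [Y].  It is convex, symmetric and lies between the two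
    balls.  If [|<x, y>| <= 1 - 2 t^2] for distinct [x], [y] in [Y], then every
    cone contains all the points of [Y], so these are boundary points of [K];
    and a unit vector [u] that illuminates [K] at [x] points into the cone of
    [x], that is, [<x, - u> >= t].  Hence [K] needs more than [m] directions as
    soon as no [m] caps [<x, w> >= t] cover [Y].

    The measure of such a cap is about [(1 - t^2)^(n/2) = D^-n], so a random
    [Y] of slightly more than [D^n] points should do: [m <= 0.05 D^n] fixed caps
    cover at most a fraction of the sphere, and it suffices to consider caps
    centred at a fine net of size [e^(O(n log n))].  The inner products stay
    below [3/5] in absolute value because a cap [<x, y> > 3/5] has measure about
    [(4/5)^n] and [(4/5) D < 1]; moreover [3/5 <= 1 - 2 t^2] when [D < 1.116].

    Two devices replace measure on the sphere and randomness.  The sample space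
    is a largest family of points at mutual distances at least [1] in a ball of
    radius [s].  A cap, seen as a cone in that ball, lies in a smaller ball, of
    radius [rho * s] ([cap_in_ball]), and therefore contains at most as many
    points as a largest family of the smaller ball.  For a suitable scale [s]
    this is at most [2 rho^n] times the size of the whole family
    ([packing_scale]), which plays the part of the homogeneity of volume.  The
    points of [Y] are then chosen one by one, each time so as to halve the number
    of [m]-tuples of caps that contain all the points chosen so far
    ([greedy_selection], [spread_points]).

    That the illumination number is a covering number holds for every convex body
    with a boundary point: if a set of directions illuminates the boundary, then
    by compactness moving along one of them by a single small step
    brings any point of [K] into the interior ([uniform_illumination]). *)

(** * The Euclidean inner product *)

Section Dot.
Context {R : realType} {n : nat}.
Implicit Types (x y z u v : 'rV[R]_n).

Definition dot x y : R := \sum_(i < n) x ord0 i * y ord0 i.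

Lemma dotC x y : dot x y = dot y x.
Proof. by apply: eq_bigr => i _; rewrite mulrC. Qed.

Lemma dotDl x y z : dot (x + y) z = dot x z + dot y z.
Proof. by rewrite -big_split; apply: eq_bigr => i _; rewrite !mxE mulrDl. Qed.

Lemma dotZl a x y : dot (a *: x) y = a * dot x y.
Proof. by rewrite mulr_sumr; apply: eq_bigr => i _; rewrite !mxE mulrA. Qed.

Lemma dotNl x y : dot (- x) y = - dot x y.
Proof. by rewrite -scaleN1r dotZl mulN1r. Qed.

Lemma dotDr x y z : dot x (y + z) = dot x y + dot x z.
Proof. by rewrite dotC dotDl !(dotC x). Qed.

Lemma dotZr a x y : dot x (a *: y) = a * dot x y.
Proof. by rewrite dotC dotZl dotC. Qed.

Lemma dotNr x y : dot x (- y) = - dot x y.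
Proof. by rewrite dotC dotNl dotC. Qed.

Lemma dot0l x : dot 0 x = 0.
Proof. by apply: big1 => i _; rewrite mxE mul0r. Qed.

Lemma dot0r x : dot x 0 = 0.
Proof. by rewrite dotC dot0l. Qed.

Definition dotE := (dotDl, dotDr, dotNl, dotNr, dotZl, dotZr).

Lemma dot_ge0 x : 0 <= dot x x.
Proof. by apply: sumr_ge0 => i _; rewrite -expr2 sqr_ge0. Qed.

Lemma enorm_ge0 x : 0 <= enorm x.
Proof. exact: sqrtr_ge0. Qed.

Lemma sqr_enorm x : enorm x ^+ 2 = dot x x.
Proof.
rewrite sqr_sqrtr; first by apply: eq_bigr => i _; rewrite expr2.
by apply: sumr_ge0 => i _; rewrite sqr_ge0.
Qed.

Lemma enorm_le x (r : R) : 0 <= r -> (enorm x <= r) = (dot x x <= r ^+ 2).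
Proof.
by move=> r0; rewrite -sqr_enorm ler_pXn2r ?nnegrE ?enorm_ge0.
Qed.

Lemma enorm_ge x (r : R) : 0 <= r -> (r <= enorm x) = (r ^+ 2 <= dot x x).
Proof.
by move=> r0; rewrite -sqr_enorm ler_pXn2r ?nnegrE ?enorm_ge0.
Qed.

Lemma enorm_eq x (r : R) : 0 <= r -> dot x x = r ^+ 2 -> enorm x = r.
Proof.
move=> r0 xr; apply/eqP.
by rewrite -(@eqrXn2 _ 2) ?enorm_ge0 ?sqr_enorm ?xr.
Qed.

Lemma enorm_unit x : enorm x = 1 -> dot x x = 1.
Proof. by move=> x1; rewrite -sqr_enorm x1 expr1n. Qed.

Lemma enorm0 : enorm (0 : 'rV[R]_n) = 0.
Proof. by apply: enorm_eq => //; rewrite dot0l expr0n. Qed.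

Lemma enormN x : enorm (- x) = enorm x.
Proof. by apply: enorm_eq; rewrite ?enorm_ge0 // sqr_enorm !dotE opprK. Qed.

Lemma enormZ a x : enorm (a *: x) = `|a| * enorm x.
Proof.
apply: enorm_eq; first by rewrite mulr_ge0 ?enorm_ge0.
by rewrite exprMn sqr_enorm !dotE real_normK ?num_real // mulrA.
Qed.

Lemma coord_le_enorm x i : `|x ord0 i| <= enorm x.
Proof.
rewrite enorm_ge // real_normK ?num_real //.
rewrite /dot (bigD1 i) //= -expr2 lerDl.
by apply: sumr_ge0 => j _; rewrite -expr2 sqr_ge0.
Qed.

Lemma dot_le_coord x (r : R) :
  (forall i, `|x ord0 i| <= r) -> dot x x <= n%:R * r ^+ 2.
Proof.
move=> xr; apply: (@le_trans _ _ (\sum_(i < n) r ^+ 2)).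
  apply: ler_sum => i _; rewrite -expr2 -(real_normK (num_real _)).
  by apply: lerXn2r; rewrite ?nnegrE ?(le_trans _ (xr i)) ?xr.
by rewrite sumr_const card_ord mulr_natl.
Qed.

Lemma enorm_eq0 x : (enorm x == 0) = (x == 0).
Proof.
apply/eqP/eqP => [x0|->]; last exact: enorm0.
apply/rowP => i; rewrite mxE; apply/eqP; rewrite -normr_le0 -x0.
exact: coord_le_enorm.
Qed.

Lemma enorm_gt0 x : (0 < enorm x) = (x != 0).
Proof. by rewrite lt_def enorm_ge0 andbT enorm_eq0. Qed.

Lemma cauchy_schwarz x y : `|dot x y| <= enorm x * enorm y.
Proof.
have xy0 : 0 <= enorm x * enorm y by rewrite mulr_ge0 ?enorm_ge0.
rewrite -(@ler_pXn2r _ 2) ?nnegrE // real_normK ?num_real //.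
rewrite exprMn !sqr_enorm.
have [->|yn0] := eqVneq y 0.
  by rewrite !dot0r mulr0 expr0n.
have y0 : 0 < dot y y by rewrite -sqr_enorm exprn_gt0 // enorm_gt0.
have := dot_ge0 (dot y y *: x - dot x y *: y).
rewrite !dotE (dotC y x) => h.
rewrite -(ler_pM2l y0); nra.
Qed.

Lemma dot_le x y : dot x y <= enorm x * enorm y.
Proof. exact: le_trans (ler_norm _) (cauchy_schwarz x y). Qed.

Lemma enormD x y : enorm (x + y) <= enorm x + enorm y.
Proof.
rewrite enorm_le ?addr_ge0 ?enorm_ge0 //.
rewrite sqrrD !sqr_enorm !dotE (dotC y x).
have := dot_le x y; lra.
Qed.

Lemma enorm_normalize x : x != 0 -> enorm ((enorm x)^-1 *: x) = 1.
Proof.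
rewrite -enorm_gt0 => x0.
by rewrite enormZ normfV ger0_norm ?enorm_ge0 // mulVf ?gt_eqF.
Qed.

End Dot.

(** * Illumination and covering numbers *)

Section Illumination.
Context {R : realType} {n : nat}.
Implicit Types (x u b t : 'rV[R]_n) (K L A : set 'rV[R]_n).

(** Cardinality does not grow under images; coverings and illuminating sets will
    be turned into each other by taking an image and discarding elements. *)
Lemma min_card_le_image (P Q : set (set 'rV[R]_n)) :
  (forall A, P A -> exists2 B, Q B &
    exists f : 'rV[R]_n -> 'rV[R]_n, B `<=` f @` A) ->
  (min_card Q <= min_card P)%E.
Proof.
move=> PQ; apply: le_ereal_inf_tmp => _ [m [A Am PA] <-].
have [B QB [f BfA]] := PQ A PA.
have BA : (B #<= `I_m)%card.
  rewrite -(card_le_eqr Am).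
  exact: card_le_trans (subset_card_le BfA) (card_image_le f A).
have /finite_setP[k Bk] : finite_set B.
  exact: sub_finite_set BfA (finite_image f (ex_intro _ m Am)).
apply: ge_ereal_inf; exists (k%:R)%:E; first by exists k => //; exists B.
by rewrite lee_fin ler_nat -card_le_II -(card_le_eql Bk).
Qed.

Lemma convex_setP K : convex_set K <->
  forall x y (a : R), K x -> K y -> 0 <= a -> a <= 1 -> K (a *: x + (1 - a) *: y).
Proof.
split=> [Kc x y a Kx Ky a0 a1|H x y l].
  have a01 : Itv.spec (@Itv.num_sem R) (Itv.Real `[0%Z, 1%Z]) a.
    rewrite /= /Itv.num_sem /= num_real /= in_itv /= a0 /=.
    by rewrite ?mulr1z a1.
  have := Kc x y (Itv.mk a01); rewrite !inE; exact.
rewrite !inE => Kx Ky; apply: H => //; exact: le1.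
Qed.

Lemma continuous_dilation (a : R) (q p : 'rV[R]_n) :
  {for p, continuous (fun z : 'rV[R]_n => a *: (z - q))}.
Proof.
apply: continuousZ; first exact: cst_continuous.
by apply: continuousB; [exact: cvg_id|exact: cst_continuous].
Qed.

Lemma continuous_translation (q p : 'rV[R]_n) :
  {for p, continuous (fun z : 'rV[R]_n => z + q)}.
Proof. by apply: continuousD; [exact: cvg_id|exact: cst_continuous]. Qed.

Lemma continuous_ray (p u : 'rV[R]_n) (a : R) :
  {for a, continuous (fun l : R => p + l *: u)}.
Proof.
apply: continuousD; first exact: cst_continuous.
by apply: continuousZr_tmp; exact: cvg_id.
Qed.

(** The dilation with centre [x] and ratio [a] takes [y] to the given point, and
    a neighbourhood of [y] inside [K] to a neighbourhood of that point inside
    [K]. *)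
Lemma interior_segment K x y (a : R) :
  convex_set K -> K x -> interior K y -> 0 < a -> a <= 1 ->
  interior K ((1 - a) *: x + a *: y).
Proof.
move=> /convex_setP Kc Kx Ky a0 a1.
pose g z := a^-1 *: (z - (1 - a) *: x).
have gy : g ((1 - a) *: x + a *: y) = y.
  by rewrite /g addrC addKr scalerA mulVf ?gt_eqF // scale1r.
have gc := @continuous_dilation a^-1 ((1 - a) *: x) ((1 - a) *: x + a *: y).
have Kg : nbhs ((1 - a) *: x + a *: y) (g @^-1` K) by apply: gc; rewrite -/(g _) gy.
suff gK : g @^-1` K `<=` K by exact: filterS gK Kg.
move=> z /= Kgz.
have -> : z = a *: g z + (1 - a) *: x.
  by rewrite /g scalerA mulfV ?gt_eqF // scale1r subrK.
by apply: Kc => //; lra.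
Qed.

Lemma near_translate_interior K x v :
  interior K (x + v) -> \forall z \near x, interior K (z + v).
Proof.
move=> Kxv.
have gc := @continuous_translation v x.
have : nbhs (x + v) (interior K).
  by apply: open_nbhs_nbhs; split=> //; exact: open_interior.
by move=> /gc.
Qed.

(** Every point of [K] is moved into the interior by a small step along some
    direction of [U]: boundary points by hypothesis, interior points along any
    direction.  If a step of length [l] works at [x], it works at all points
    near [x], and by convexity so does every shorter step; compactness gives a
    common length. *)
Lemma uniform_illumination K (U : set 'rV[R]_n) :
  convex_body K -> boundary K !=set0 ->
  (forall b, boundary K b -> exists2 u, U u & illuminates u K b) ->
  exists2 l : R, 0 < l & forall x, K x -> exists2 u, U u & interior K (x + l *: u).
Proof.
move=> [Kcomp Kconv [z Kz]] [b0 Kb0] HU.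
have Kcl : closed K by apply: compact_closed => //; exact: norm_hausdorff.
have exU x : K x -> exists2 u, U u & exists2 l : R, 0 < l & interior K (x + l *: u).
  move=> Kx; have [Kix|nKix] := pselect (interior K x); last first.
    have [|u Uu [l l0 ul]] := HU x; last by exists u => //; exists l.
    by split=> //; exact: subset_closure.
  have [u Uu _] := HU _ Kb0; exists u => //.
  have gc := @continuous_ray x u 0.
  have : nbhs (x + (0 : R) *: u) (interior K).
    by rewrite scale0r addr0; apply: open_nbhs_nbhs; split=> //; exact: open_interior.
  move=> /gc /nbhs_ballP[e /= e0 he]; exists (e / 2); first by rewrite divr_gt0.
  apply: he; rewrite /ball /= sub0r normrN gtr0_norm ?divr_gt0 //; lra.
move: Kcomp => /compact_near_coveringP /near_covering_withinP.
pose P (l : R) x := exists2 u, U u & interior K (x + l *: u).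
move=> /(_ R (at_right 0) P _) [].
  move=> x Kx; have [u Uu [l l0 ul]] := exU x Kx.
  near=> y l' => Ky; exists u => //.
  have l'0 : 0 < l' by near: l'; exact: nbhs_right_gt.
  have l'l : l' <= l by near: l'; exact: nbhs_right_le.
  have yl : interior K (y + l *: u).
    by near: y; exact: near_translate_interior.
  have -> : y + l' *: u = (1 - l' / l) *: y + (l' / l) *: (y + l *: u).
    rewrite scalerDr scalerA divfK ?gt_eqF // addrA -scalerDl subrK scale1r //.
  apply: interior_segment => //; first by rewrite divr_gt0.
  by rewrite ler_pdivrMr // mul1r.
move=> e /= e0 he; exists (e / 2); first by rewrite divr_gt0.
apply: he; last by rewrite divr_gt0.
rewrite /= sub0r normrN gtr0_norm ?divr_gt0 //; lra.
Unshelve. all: by end_near.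
Qed.

(** A boundary point in the translate of the interior by [t] is illuminated by
    [- t / |t|].  Conversely the translates of the interior by [- l *: u], for
    the uniform step length [l], cover [K].  Without boundary points the two
    numbers differ: they are 0 and 1 in dimension 0. *)
Lemma illumination_eq_covering K : convex_body K -> boundary K !=set0 ->
  illumination_number K = covering_number K (interior K).
Proof.
move=> Kb bK; apply/eqP; rewrite eq_le; apply/andP; split.
  apply: min_card_le_image => T /= KT.
  exists [set - (enorm t)^-1 *: t | t in T `\ 0]; last first.
    by exists (fun t => - (enorm t)^-1 *: t); apply: image_subset => t [].
  split=> [_ [t [_ /eqP t0] <-]|b [bcl bint]].
    by rewrite /unit_sphere /= scaleNr enormN enorm_normalize.
  have Kcl : closed K.
    by case: Kb => Kcomp _ _; apply: compact_closed => //; exact: norm_hausdorff.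
  have [t Tt [x Kx xb]] := KT b (Kcl _ bcl).
  have [t0|t0] := eqVneq t 0; first by case: bint; rewrite -xb t0 add0r.
  exists (- (enorm t)^-1 *: t); first by exists t => //; split=> //; exact/eqP.
  exists (enorm t); first by rewrite enorm_gt0.
  rewrite scalerA mulrN mulfV ?enorm_eq0 // scaleN1r -xb addrC addKr //.
apply: min_card_le_image => U [_ HU].
have [l l0 lU] := uniform_illumination Kb bK HU.
exists [set - (l *: u) | u in U]; last by exists (fun u => - (l *: u)).
move=> x Kx; have [u Uu Ku] := lU x Kx.
exists (- (l *: u)); first by exists u.
by exists (x + l *: u) => //; rewrite addrC addrK.
Qed.

End Illumination.

(** * The spiky body *)

Section Topology.
Context {R : realType} {n : nat}.
Implicit Types (x y : 'rV[R]_n).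

Lemma sub_unit_ball_bounded (A : set 'rV[R]_n) :
  A `<=` unit_ball R n -> bounded_set A.
Proof.
move=> AB; exists 1; split; first exact: num_real.
move=> M /ltW M1 y /AB /= y1; apply: le_trans M1.
rewrite /Num.norm /= mx_normrE; apply/bigmax_leP; split=> // -[i j] _ /=.
by rewrite ord1; exact: le_trans (coord_le_enorm y j) y1.
Qed.

(** Links the topology, which comes from the sup norm, to the Euclidean norm;
    the factor [n.+1] instead of [n] keeps the radius positive when [n = 0]. *)
Lemma nbhs_enorm x (r : R) : 0 < r -> nbhs x [set y | enorm (y - x) <= r].
Proof.
move=> r0; apply/nbhs_ballP; exists (r / n.+1%:R) => /=; first by rewrite divr_gt0.
move=> y; rewrite mx_norm_ball /ball_ /= distrC => yr.
rewrite enorm_le ?(ltW r0) //.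
have /dot_le_coord/le_trans : forall i, `|(y - x) ord0 i| <= r / n.+1%:R.
  move=> i; apply: le_trans (ltW yr); rewrite [leRHS]/Num.norm /= mx_normrE.
  by apply/bigmax_geP; right; exists (ord0, i).
apply; rewrite expr_div_n mulrA ler_pdivrMr ?exprn_gt0 //.
by rewrite mulrC ler_pM2l ?exprn_gt0 // -natrX ler_nat; lia.
Qed.

Lemma closed_sublevel (F : 'rV[R]_n -> R) (L c : R) :
  (forall y z, F y <= F z + L * enorm (z - y)) -> closed [set y | F y <= c].
Proof.
move=> FL y cly /=; apply/ler_addgt0Pr => e e0.
have L1 : 0 < `|L| + 1 by rewrite ltr_wpDl.
have [z [/= zc zy]] := cly _ (nbhs_enorm y (divr_gt0 e0 L1)).
apply: le_trans (FL y z) _; apply: lerD => //.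
apply: (@le_trans _ _ ((`|L| + 1) * enorm (z - y))).
  by apply: ler_wpM2r; rewrite ?enorm_ge0 // (le_trans (ler_norm L)) // lerDl.
by rewrite -ler_pdivlMl // mulrC.
Qed.

End Topology.

Section SpikyBody.
Context {R : realType} {n : nat}.
Implicit Types (x y z u : 'rV[R]_n) (t : R) (Y : set 'rV[R]_n).

(** For a unit vector [x] this is the set of [y] with
    [t * |y - x| <= <x - y, x>]: the cone with apex [x], axis towards the origin
    and half-angle [arccos t], tangent to the ball of radius
    [sqrt (1 - t ^+ 2)]. *)
Definition spike_cone t x : set 'rV[R]_n :=
  [set y | t * enorm (y - x) + dot y x <= 1].

(** A substitute for the convex hull of a ball and the points of [Y] and [- Y]:
    for an intersection of cones, closedness, convexity and the shape near the
    spikes are immediate. *)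
Definition spiky_body t Y : set 'rV[R]_n :=
  [set y | enorm y <= 1 /\
    forall x, Y x -> spike_cone t x y /\ spike_cone t x (- y)].

Lemma enorm_sub_le y z : enorm y <= enorm z + enorm (z - y).
Proof. by have := enormD z (y - z); rewrite -(enormN (z - y)) opprB addrC subrK. Qed.

Lemma closed_spike_cone t x : 0 <= t -> enorm x = 1 -> closed (spike_cone t x).
Proof.
move=> t0 x1; apply: (@closed_sublevel _ _ _ (t + 1)) => y z.
have h1 := enorm_sub_le (y - x) (z - x).
have h2 := cauchy_schwarz (z - y) x.
move: h1 h2; rewrite opprB [z - x + _]addrA subrK x1 mulr1 !dotE ler_norml.
move=> h1 /andP[h2 _]; nra.
Qed.

Lemma closed_spiky_body t Y : 0 <= t -> Y `<=` unit_sphere R n ->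
  closed (spiky_body t Y).
Proof.
move=> t0 Y1 y cly; split.
  have /(_ _) := @closed_sublevel _ _ (@enorm R n) 1 1.
  move=> /(_ _ y) /=; apply; first by move=> ? ?; rewrite mul1r enorm_sub_le.
  by move=> B /cly [z [[z1 _] zB]]; exists z.
move=> x Yx; have x1 := Y1 _ Yx; split.
  apply: (closed_spike_cone t0 x1) => B /cly [z [[_ zK] zB]].
  by exists z; split=> //; case: (zK _ Yx).
have Nx1 : enorm (- x) = 1 by rewrite enormN.
have flip z : spike_cone t x (- z) = spike_cone t (- x) z.
  by rewrite /spike_cone /= -enormN opprD !opprK dotNl dotNr.
rewrite flip; apply: (closed_spike_cone t0 Nx1) => B /cly [z [[_ zK] zB]].
by exists z; split=> //; rewrite -flip; case: (zK _ Yx).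
Qed.

Lemma spike_cone_convex t x y z (a : R) : 0 <= t -> 0 <= a -> a <= 1 ->
  spike_cone t x y -> spike_cone t x z -> spike_cone t x (a *: y + (1 - a) *: z).
Proof.
move=> t0 a0 a1 yx zx; rewrite /spike_cone /=.
have -> : a *: y + (1 - a) *: z - x = a *: (y - x) + (1 - a) *: (z - x).
  by rewrite !scalerBr addrACA -opprD -scalerDl (_ : a + (1 - a) = 1) ?scale1r //; ring.
have := enormD (a *: (y - x)) ((1 - a) *: (z - x)).
rewrite !enormZ !ger0_norm ?subr_ge0 // !dotE => h.
move: yx zx; rewrite /spike_cone /= => yx zx.
have h' := ler_wpM2l t0 h; nra.
Qed.

Lemma spiky_body_convex t Y : 0 <= t -> convex_set (spiky_body t Y).
Proof.
move=> t0; apply/convex_setP => y z a [y1 yY] [z1 zY] a0 a1; split.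
  apply: le_trans (enormD _ _) _.
  by rewrite !enormZ !ger0_norm ?subr_ge0 //; nra.
move=> x Yx; have [y_ yN] := yY _ Yx; have [z_ zN] := zY _ Yx.
split; first exact: spike_cone_convex.
by rewrite opprD -!scalerN; exact: spike_cone_convex.
Qed.

Lemma spiky_body_symmetric t Y : o_symmetric (spiky_body t Y).
Proof.
have N y : spiky_body t Y y -> spiky_body t Y (- y).
  by move=> [y1 yY]; split=> [|x /yY []]; rewrite ?enormN // opprK.
apply/seteqP; split=> [y Ky|_ [y Ky <-]]; last exact: N.
by exists (- y); [exact: N|rewrite opprK].
Qed.

(** After squaring, the inequality becomes [(1 - <y, x> - t ^+ 2) ^+ 2 >= 0]. *)
Lemma ball_sub_spike_cone t x y : 0 <= t -> enorm x = 1 ->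
  dot y y <= 1 - t ^+ 2 -> spike_cone t x y.
Proof.
move=> t0 x1 yt; rewrite /spike_cone /=.
have xx := enorm_unit x1.
have yx1 : dot y x <= 1.
  have := dot_le y x; rewrite x1 mulr1 => /le_trans; apply.
  rewrite enorm_le // expr1n; nra.
suff : t * enorm (y - x) <= 1 - dot y x by lra.
rewrite -(@ler_pXn2r _ 2) ?nnegrE ?mulr_ge0 ?enorm_ge0 ?subr_ge0 //.
rewrite exprMn sqr_enorm !dotE (dotC x y) xx.
have := sqr_ge0 (1 - dot y x - t ^+ 2); nra.
Qed.

(** For unit vectors [|z - x| ^+ 2 = 2 (1 - <z, x>)], so that the squared
    inequality can be divided by [1 - <z, x>]. *)
Lemma unit_in_spike_cone t x z : 0 <= t -> enorm x = 1 -> enorm z = 1 ->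
  dot z x <= 1 - 2 * t ^+ 2 -> spike_cone t x z.
Proof.
move=> t0 x1 z1 zx; rewrite /spike_cone /=.
have xx := enorm_unit x1; have zz := enorm_unit z1.
have zx1 : dot z x <= 1 by nra.
suff : t * enorm (z - x) <= 1 - dot z x by lra.
rewrite -(@ler_pXn2r _ 2) ?nnegrE ?mulr_ge0 ?enorm_ge0 ?subr_ge0 //.
rewrite exprMn sqr_enorm !dotE (dotC x z) xx zz; nra.
Qed.

Lemma ball_sub_spiky_body t Y y : 0 <= t -> Y `<=` unit_sphere R n ->
  dot y y <= 1 - t ^+ 2 -> spiky_body t Y y.
Proof.
move=> t0 Y1 yt; split; first by rewrite enorm_le // expr1n; nra.
by move=> x /Y1 x1; split; apply: ball_sub_spike_cone => //; rewrite !dotE opprK.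
Qed.

Lemma spike_in_spiky_body t Y x : 0 <= t -> t <= 1 -> Y `<=` unit_sphere R n ->
  (forall y z, Y y -> Y z -> y != z -> `|dot y z| <= 1 - 2 * t ^+ 2) ->
  Y x -> spiky_body t Y x.
Proof.
move=> t0 t1 Y1 Ysep Yx; have x1 : enorm x = 1 by exact: Y1.
split=> [|y Yy]; first by rewrite x1.
have y1 : enorm y = 1 by exact: Y1.
have [->|xy] := eqVneq x y.
  split; first by rewrite /spike_cone /= subrr enorm0 mulr0 add0r enorm_unit.
  by apply: unit_in_spike_cone; rewrite ?enormN // dotNl enorm_unit //; nra.
have := Ysep _ _ Yx Yy xy; rewrite ler_norml => /andP[h1 h2].
split; apply: unit_in_spike_cone; rewrite ?enormN ?dotNl //; lra.
Qed.

(** Points slightly further out on the same ray are outside the unit ball. *)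
Lemma unit_boundary K x : K `<=` unit_ball R n -> K x -> enorm x = 1 -> boundary K x.
Proof.
move=> KB Kx x1; split; first exact: subset_closure.
move=> ix.
have gc := @continuous_ray R n x x 0.
have : nbhs (x + (0 : R) *: x) K by rewrite scale0r addr0.
move=> /gc /nbhs_ballP[e /= e0 he].
have /he /KB : ball (0 : R) e (e / 2).
  by rewrite /ball /= sub0r normrN gtr0_norm ?divr_gt0 //; lra.
rewrite /unit_ball /= -[X in X + _]scale1r -scalerDl enormZ x1 mulr1.
by rewrite ger0_norm; lra.
Qed.

(** The direction must point into the cone at [x], since the cone contains the
    whole body. *)
Lemma illuminates_spike t Y x u : Y `<=` unit_sphere R n -> Y x -> enorm u = 1 ->
  illuminates u (spiky_body t Y) x -> t <= dot x (- u).
Proof.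
move=> Y1 Yx u1 [l l0 /interior_subset [_ /(_ _ Yx) [+ _]]].
rewrite /spike_cone /= [x + _]addrC addrK enormZ u1 mulr1 gtr0_norm //.
rewrite !dotE (enorm_unit (Y1 _ Yx)) (dotC u).
nra.
Qed.

Lemma spiky_body_convex_body t Y : 0 <= t -> t < 1 -> Y `<=` unit_sphere R n ->
  convex_body (spiky_body t Y).
Proof.
move=> t0 t1 Y1; split.
- apply: bounded_closed_compact; last exact: closed_spiky_body.
  by apply: sub_unit_ball_bounded => y [].
- exact: spiky_body_convex.
exists 0; rewrite /interior.
have r0 : 0 < 1 - t by lra.
suff rK : [set y | enorm (y - 0) <= 1 - t] `<=` spiky_body t Y.
  exact: filterS rK (nbhs_enorm 0 r0).
move=> y /=; rewrite subr0 enorm_le ?(ltW r0) // => yr.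
by apply: ball_sub_spiky_body => //; nra.
Qed.

End SpikyBody.

(** * Packing numbers of balls *)

(** If no scale were good, passing from a scale [s] to some [rho * s] could be
    repeated about [log s] times, doubling [g] each time and contradicting its
    boundedness once [s] is large. *)
Lemma doubling_scale {R : realType} (g : R -> R) (c A : R) :
  0 < c -> (forall s, 1 <= s -> c <= g s <= A) ->
  exists2 s, 2 <= s & forall rho, 2^-1 <= rho -> rho <= 1 ->
    g (rho * s) <= 2 * g s.
Proof.
move=> c0 gb; apply: contrapT => H.
have step s : 2 <= s -> exists2 rho, 2^-1 <= rho <= 1 & 2 * g s < g (rho * s).
  move=> s2; apply: contrapT => H'; apply: H; exists s => // rho r1 r2.
  by rewrite leNgt; apply/negP => H2; apply: H'; exists rho => //; rewrite r1.
have chain k : forall s, 2 ^+ k <= s ->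
    exists2 s', 1 <= s' & 2 ^+ k * g s <= g s'.
  elim: k => [|k IH] s ks; first by exists s; rewrite ?mul1r.
  have k1 : 1 <= 2 ^+ k :> R by apply: exprn_ege1; rewrite ler1n.
  rewrite exprS in ks.
  have [|rho /andP[r1 r2] gr] := step s; first lra.
  have [|s' s'1 gs'] := IH (rho * s); first nra.
  exists s' => //; apply: le_trans gs'; rewrite exprS; nra.
have [k Ak] : exists k : nat, A / c < 2 ^+ k.
  exists (Num.truncn (A / c)).+1; apply: (lt_trans (truncnS_gt _)).
  by rewrite -natrX ltr_nat ltn_expl.
have [s' s'1] := chain k (2 ^+ k) (lexx _).
have k1 : 1 <= 2 ^+ k :> R by apply: exprn_ege1; rewrite ler1n.
have /andP[gc _] := gb _ k1.
have /andP[_ gA] := gb _ s'1.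
move: Ak; rewrite ltr_pdivrMr // => Ak; nra.
Qed.

Section Packing.
Context {R : realType} {n : nat}.
Implicit Types (s : R) (k : nat).
Hypothesis n0 : (0 < n)%N.

Definition separated_in_ball (I : finType) s (f : I -> 'rV[R]_n) : Prop :=
  (forall i, enorm (f i) <= s) /\
  (forall i j, i != j -> 1 <= enorm (f i - f j)).

(** Round the coordinates down to a grid of mesh [1 / (2 n)]: two points in the
    same cell are at distance less than [1]. *)
Lemma card_separated (I : finType) s (f : I -> 'rV[R]_n) :
  1 <= s -> separated_in_ball s f -> #|I|%:R <= (5 * n%:R * s) ^+ n.
Proof.
move=> s1 [fs sep].
have n1 : 1 <= n%:R :> R by rewrite ler1n.
have n00 : 0 < n%:R :> R by lra.
pose q : R := 2 * n%:R.
have q0 : 0 < q by rewrite mulr_gt0.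
pose L := Num.truncn (4 * n%:R * s).
have fpos i j : 0 <= q * (f i ord0 j + s).
  rewrite mulr_ge0 ?(ltW q0) //.
  have := le_trans (coord_le_enorm (f i) j) (fs i).
  rewrite ler_norml => /andP[]; lra.
have fL i j : (Num.truncn (q * (f i ord0 j + s)) < L.+1)%N.
  rewrite ltnS; apply: le_truncn.
  have := le_trans (coord_le_enorm (f i) j) (fs i).
  rewrite ler_norml /q => /andP[_ h]; nra.
pose code i : {ffun 'I_n -> 'I_L.+1} :=
  [ffun j => inord (Num.truncn (q * (f i ord0 j + s)))].
have code_inj : injective code.
  move=> i i' cii'; apply/eqP; apply: contraT => nii'.
  have := sep _ _ nii'; rewrite enorm_ge ?ler01 // expr1n => h1.
  have /dot_le_coord h2 : forall j, `|(f i - f i') ord0 j| <= q^-1.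
    move=> j; have /(congr1 val) := congr1 (fun c : {ffun 'I_n -> 'I_L.+1} => c j) cii'.
    rewrite !ffunE /= !inordK // => tt.
    have /andP[a1 a2] := truncn_itv (fpos i j).
    have /andP[b1 b2] := truncn_itv (fpos i' j).
    move: a1 a2; rewrite tt => a1 a2.
    rewrite !mxE -[leRHS]mul1r ler_pdivlMr // -(gtr0_norm q0) -normrM ler_norml.
    rewrite -natr1 in a2 b2; apply/andP; split; lra.
  have := le_trans h1 h2.
  rewrite exprVn ler_pdivlMr ?exprn_gt0 // mul1r /q; nra.
have := leq_card code code_inj.
rewrite card_ffun !card_ord -(ler_nat R) natrX => /le_trans; apply.
apply: lerXn2r; rewrite ?nnegrE ?ler0n //; first nra.
rewrite -natr1; have : L%:R <= 4 * n%:R * s by rewrite truncn_le; nra.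
nra.
Qed.

Definition is_packing_number s k : Prop :=
  (exists f : 'I_k -> 'rV[R]_n, separated_in_ball s f) /\
  (forall k' (f : 'I_k' -> 'rV[R]_n), separated_in_ball s f -> (k' <= k)%N).

(** The value 0 outside the range where a largest family exists is a junk
    value; only radii at least [1] occur. *)
Definition packing_number s : nat := xget 0%N [set k | is_packing_number s k].

Lemma packing_numberP s : 1 <= s -> is_packing_number s (packing_number s).
Proof.
move=> s1; rewrite /packing_number; case: xgetP => [k -> //|no].
pose P := fun k => `[< exists f : 'I_k -> 'rV[R]_n, separated_in_ball s f >].
have P0 : exists k, P k.
  exists 0%N; apply/asboolP; exists (fun=> 0).
  by split=> [[]|[]] //.
have Pub k : P k -> (k <= Num.truncn ((5 * n%:R * s) ^+ n))%N.
  move=> /asboolP[f fP]; have := card_separated s1 fP; rewrite card_ord.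
  by rewrite truncn_ge_nat ?exprn_ge0 // mulr_ge0 ?mulr_ge0 //; lra.
case: (ex_maxnP P0 Pub) => k /asboolP kP kmax; exfalso; apply: (no k).
by split=> // k' f fP; apply: kmax; apply/asboolP; exists f.
Qed.

(** The points of a separated family that lie in some ball of radius [r] form,
    after translation, a competitor for the packing number of [r]. *)
Lemma card_separated_subset (I : finType) s (f : I -> 'rV[R]_n) (c : 'rV[R]_n)
    r (A : {set I}) :
  1 <= r -> separated_in_ball s f -> (forall i, i \in A -> enorm (f i - c) <= r) ->
  (#|A| <= packing_number r)%N.
Proof.
move=> r1 [_ sep] Ar; have [_] := packing_numberP r1.
move=> /(_ _ (fun j : 'I_#|A| => f (enum_val j) - c)); apply; split.
  by move=> j; apply/Ar/enum_valP.
move=> i j ij; rewrite opprB addrA subrK; apply: sep.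
by rewrite (inj_eq enum_val_inj).
Qed.

(** Points with integer coordinates between [0] and [s / n] form a separated
    family. *)
Lemma packing_number_ge s : 1 <= s -> (s / n%:R) ^+ n <= (packing_number s)%:R.
Proof.
move=> s1; have [_ pmax] := packing_numberP s1.
have n00 : 0 < n%:R :> R by rewrite ltr0n.
pose L := Num.truncn (s / n%:R).
have sn0 : 0 <= s / n%:R by rewrite divr_ge0 //; lra.
pose T := {ffun 'I_n -> 'I_L.+1}.
pose pt (c : T) : 'rV[R]_n := \row_j (c j)%:R.
have : (#|T| <= packing_number s)%N.
  apply: (pmax _ (fun j : 'I_#|T| => pt (enum_val j))); split.
    move=> j; rewrite enorm_le; last lra.
    have := @dot_le_coord _ _ (pt (enum_val j)) (s / n%:R).
    move=> /(_ _)/le_trans; apply.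
      move=> i; rewrite mxE normr_nat -truncn_ge_nat // -ltnS; exact: ltn_ord.
    have -> : n%:R * (s / n%:R) ^+ 2 = s ^+ 2 / n%:R by field; rewrite gt_eqF.
    by rewrite ler_pdivrMr // ler_peMr ?sqr_ge0 ?ler1n.
  move=> i j ij.
  have [x xij] : exists x, enum_val i x != enum_val j x.
    apply/existsP; apply: contraR ij; rewrite negb_exists => /forallP h.
    by apply/eqP/enum_val_inj/ffunP => x; apply/eqP; rewrite -[_ == _]negbK h.
  apply: le_trans (coord_le_enorm _ x); rewrite !mxE.
  have {}xij : nat_of_ord (enum_val i x) != enum_val j x by [].
  move: xij; rewrite neq_ltn => /orP[] lt; [rewrite distrC|];
    by rewrite -natrB ?(ltnW lt) // normr_nat ler1n subn_gt0.
rewrite -(ler_nat R) card_ffun !card_ord natrX; apply: le_trans.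
apply: lerXn2r; rewrite ?nnegrE ?ler0n //.
by rewrite ltW // truncnS_gt.
Qed.

(** The packing number is bounded above and below by constant multiples of
    [s ^+ n], so at some scale it behaves, up to a factor 2, as if it were
    homogeneous of degree [n]. *)
Lemma packing_scale :
  exists2 s, 2 <= s & forall rho, 2^-1 <= rho -> rho <= 1 ->
    (packing_number (rho * s))%:R <= 2 * rho ^+ n * (packing_number s)%:R.
Proof.
have n00 : 0 < n%:R :> R by rewrite ltr0n.
have [||s s2 h] := @doubling_scale R (fun s => (packing_number s)%:R / s ^+ n)
    (n%:R^-1 ^+ n) ((5 * n%:R) ^+ n).
- by rewrite exprn_gt0 // invr_gt0.
- move=> s s1; have s0 : 0 < s ^+ n by rewrite exprn_gt0 //; lra.
  rewrite ler_pdivlMr // ler_pdivrMr // -!exprMn mulrC packing_number_ge //=.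
  have [[f fP] _] := packing_numberP s1.
  by have := card_separated s1 fP; rewrite card_ord.
exists s => // rho r1 r2; have := h rho r1 r2.
have s0 : 0 < s ^+ n by rewrite exprn_gt0 //; lra.
have r0 : 0 < rho ^+ n by rewrite exprn_gt0 //; lra.
rewrite exprMn ler_pdivrMr ?mulr_gt0 // => /le_trans; apply.
by rewrite le_eqVlt; apply/orP; left; apply/eqP; field; apply: lt0r_neq0; lra.
Qed.

End Packing.

(** * Greedy selection *)

(** Choose the points one after the other; [conf x] stands for the points too
    close to [x].  The points in conflict with the at most [N] previous ones make up at
    most a quarter of [T]; each [c] covers at most another quarter; so, on
    average over the admissible points, at most a third of the surviving [c],
    those that cover all the points chosen so far, cover the next point as well.
    A point at most average in this respect halves the number of survivors, and
    after [N] steps none is left. *)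
Lemma greedy_selection (T C : finType) (cov : C -> {set T}) (conf : T -> {set T})
    (N : nat) :
  (0 < #|T|)%N ->
  (forall x y, (x \in conf y) = (y \in conf x)) ->
  (forall c, 4 * #|cov c| <= #|T|)%N ->
  (forall x, 4 * N * #|conf x| <= #|T|)%N ->
  (#|C| < 2 ^ N)%N ->
  exists2 X : seq T,
    {in X &, forall x y, x != y -> x \notin conf y} &
    forall c, exists2 x, x \in X & x \notin cov c.
Proof.
move=> T0 conf_sym Hcov Hconf HC.
pose surv (X : seq T) : {set C} := [set c | all (fun x => x \in cov c) X]%SET.
have step k : (k <= N)%N -> exists X : seq T,
    [/\ size X = k, {in X &, forall x y, x != y -> x \notin conf y} &
        (2 ^ k * #|surv X| <= #|C|)%N].
  elim: k => [|k IH] kN.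
    by exists [::]; split=> //; rewrite mul1n max_card.
  have [X [sX pX HX]] := IH (ltnW kN).
  pose F : {set T} := [set x | has (fun y => x \in conf y) X]%SET.
  have F4 : (4 * #|F| <= #|T|)%N.
    have FZ (Z : seq T) :
        (4 * N * #|[set x | has (fun y => x \in conf y) Z]%SET| <= size Z * #|T|)%N.
      elim: Z => [|y Z IHZ].
        by rewrite (_ : [set x | _]%SET = finset.set0) ?cards0 ?muln0.
      rewrite (_ : [set x | _]%SET =
          conf y :|: [set x | has (fun y => x \in conf y) Z]%SET).
        apply: leq_trans (leq_mul (leqnn (4 * N)) (leq_card_setU _ _).1) _.
        by rewrite mulnDr mulSn leq_add.
      by apply/setP => x; rewrite !inE.
    have := FZ X; rewrite sX -/F => FX.
    have N0 : (0 < N)%N by lia.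
    rewrite -(leq_pmul2l N0); nia.
  pose S := surv X.
  have [x xA xS] : exists2 x, x \in ~: F &
      (2 * #|[set c in S | x \in cov c]%SET| <= #|S|)%N.
    apply: contrapT => H.
    (* Count in two ways the pairs of an admissible point and a survivor that
       covers it. *)
    have cnt : (\sum_(x in ~: F) #|[set c in S | x \in cov c]%SET| =
                \sum_(c in S) #|~: F :&: cov c|)%N.
      transitivity (\sum_(x in ~: F) \sum_(c in S) (x \in cov c))%N.
        apply: eq_bigr => x _; rewrite -sum1_card big_mkcond [RHS]big_mkcond /=.
        apply: eq_bigr => c _; rewrite inE.
        by case: (c \in S) (x \in cov c) => [] [].
      rewrite exchange_big; apply: eq_bigr => c _.
      rewrite -sum1_card big_mkcond [RHS]big_mkcond /=.
      apply: eq_bigr => x _; rewrite finset.in_setI finset.in_setC.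
      by case: (x \in F); case: (x \in cov c).
    have up : (4 * \sum_(c in S) #|~: F :&: cov c| <= #|S| * #|T|)%N.
      rewrite big_distrr /= -sum_nat_const; apply: leq_sum => c _.
      apply: leq_trans (Hcov c); rewrite leq_mul2l subset_leq_card ?orbT //.
      exact: subsetIr.
    have low : (#|~: F| * #|S|.+1 <=
        2 * \sum_(x in ~: F) #|[set c in S | x \in cov c]%SET|)%N.
      rewrite big_distrr /= -sum_nat_const; apply: leq_sum => x xF.
      by rewrite ltnNge; apply/negP => h; apply: H; exists x.
    have := cardsC F; rewrite cnt in low; nia.
  exists (x :: X); split; first by rewrite /= sX.
    have xX y : y \in X -> x \notin conf y.
      by move: xA; rewrite !inE => + yX; apply: contraNN => xy; apply/hasP; exists y.
    move=> y z; rewrite !inE => /orP[/eqP->|yX] /orP[/eqP->|zX] yz.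
    - by rewrite eqxx in yz.
    - exact: xX.
    - by rewrite conf_sym xX.
    - exact: pX.
  rewrite expnS mulnAC; apply: leq_trans HX; rewrite mulnC leq_mul2l.
  apply/orP; right; apply: leq_trans xS; rewrite leq_mul2l; apply/orP; right.
  by apply: subset_leq_card; apply/fintype.subsetP => c; rewrite !inE /= andbC.
have [X [_ pX HX]] := step N (leqnn N).
exists X => // c; apply/hasP; apply: contraLR HC; rewrite has_predC negbK => cX.
rewrite -leqNgt; apply: leq_trans HX; rewrite leq_pmulr // card_gt0.
by apply/set0Pn; exists c; rewrite inE.
Qed.

(** * Caps and well spread points on the sphere *)

Section Caps.
Context {R : realType} {n : nat}.
Implicit Types (x u v : 'rV[R]_n) (s t : R).

(** The cone over a cap of angular radius between 45 and 90 degrees, cut off at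
    radius [s], lies in the ball whose equator is the rim of the cap.  On the cone the
    squared distance to the centre is at most a convex quadratic function of
    [|x|], so it is enough to look at [|x| = 0], where [2 * t ^+ 2 <= 1] is
    used, and at [|x| = s]. *)
Lemma cap_in_ball x v s t : 0 <= t -> 2 * t ^+ 2 <= 1 -> enorm v = 1 ->
  enorm x <= s -> t * enorm x <= dot x v ->
  enorm (x - (s * t) *: v) <= Num.sqrt (1 - t ^+ 2) * s.
Proof.
move=> t0 t2 v1 xs xv.
have x0 := enorm_ge0 x.
have s0 : 0 <= s by lra.
rewrite enorm_le ?mulr_ge0 ?sqrtr_ge0 // exprMn sqr_sqrtr; last lra.
rewrite !dotE (enorm_unit v1) (dotC v) -sqr_enorm.
have h1 : s * t * (t * enorm x) <= s * t * dot x v.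
  by apply: ler_wpM2l => //; rewrite mulr_ge0.
have h2 : 0 <= (s - enorm x) * (s + enorm x - 2 * t ^+ 2 * s).
  by apply: mulr_ge0; nra.
nra.
Qed.

(** A largest [d]-separated family of unit vectors is a net; its size is bounded
    by rescaling it to a 1-separated family. *)
Lemma sphere_net (d : R) : (0 < n)%N -> 0 < d -> d <= 1 ->
  exists (k : nat) (v : 'I_k -> 'rV[R]_n),
    [/\ forall i, enorm (v i) = 1,
        forall u, enorm u = 1 -> exists i, enorm (u - v i) <= d &
        k%:R <= (5 * n%:R / d) ^+ n].
Proof.
move=> n0 d0 d1.
pose P k := `[< exists v : 'I_k -> 'rV[R]_n, (forall i, enorm (v i) = 1) /\
  forall i j, i != j -> d < enorm (v i - v j) >].
have Pub k : P k -> k%:R <= (5 * n%:R / d) ^+ n.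
  move=> /asboolP[v [v1 vsep]]; rewrite -{1}(card_ord k).
  apply: (@card_separated _ _ n0 _ _ (fun i => d^-1 *: v i)).
    by rewrite invf_ge1.
  split=> [i|i j ij]; first by rewrite enormZ v1 mulr1 gtr0_norm // invr_gt0.
  rewrite -scalerBr enormZ gtr0_norm ?invr_gt0 // mulrC ler_pdivlMr // mul1r.
  exact: ltW (vsep _ _ ij).
have P0 : exists k, P k.
  by exists 0%N; apply/asboolP; exists (fun=> 0); split=> [[]|[]].
have Pub' k : P k -> (k <= Num.truncn ((5 * n%:R / d) ^+ n))%N.
  move=> /Pub; rewrite truncn_ge_nat // exprn_ge0 // divr_ge0 ?mulr_ge0 //; exact: ltW.
case: (ex_maxnP P0 Pub') => k Pk kmax; have := Pub _ Pk.
move: Pk => /asboolP[v [v1 vsep]] kub; exists k, v; split=> // u u1.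
apply: contrapT => far.
have ud i : d < enorm (u - v i).
  by rewrite ltNge; apply/negP => ui; apply: far; exists i.
suff /kmax : P k.+1 by rewrite ltnn.
apply/asboolP.
exists (fun i => if unlift ord0 i is Some j then v j else u); split=> [i|i j ij].
  by case: unliftP.
case: (unliftP ord0 i) ij => [i' ->|->]; case: (unliftP ord0 j) => [j' ->|->].
- by rewrite (inj_eq lift_inj); exact: vsep.
- by move=> _; rewrite -enormN opprB.
- by move=> _; exact: ud.
- by rewrite eqxx.
Qed.

Definition cap (I : finType) (f : I -> 'rV[R]_n) t v : {set I} :=
  [set i | t * enorm (f i) <= dot (f i) v]%SET.

Lemma card_cap_le s (I : finType) (f : I -> 'rV[R]_n) v t : (0 < n)%N ->
  0 <= t -> 2 * t ^+ 2 <= 1 -> enorm v = 1 -> 2 <= s ->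
  (forall rho, 2^-1 <= rho -> rho <= 1 -> (@packing_number R n (rho * s))%:R <=
    2 * rho ^+ n * (@packing_number R n s)%:R :> R) ->
  separated_in_ball s f ->
  #|cap f t v|%:R <=
    2 * Num.sqrt (1 - t ^+ 2) ^+ n * (@packing_number R n s)%:R :> R.
Proof.
move=> n0 t0 t2 v1 s2 good fsep.
have r1 : 2^-1 <= Num.sqrt (1 - t ^+ 2).
  rewrite -(@ler_pXn2r _ 2) ?nnegrE ?sqrtr_ge0 ?invr_ge0 // sqr_sqrtr; nra.
have r2 : Num.sqrt (1 - t ^+ 2) <= 1.
  by rewrite -[leRHS]sqrtr1 ler_wsqrtr //; nra.
apply: le_trans (good _ r1 r2); rewrite ler_nat.
apply: (card_separated_subset n0 (c := (s * t) *: v) _ fsep); first nra.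
by move=> i; rewrite inE => iv; apply: cap_in_ball => //; case: fsep.
Qed.

(** Apply the greedy selection to a largest separated family at a good scale and
    normalize the selected points.  Since [0] belongs to every cap and [m] is
    positive, uncovered points can be normalized.  The conflict relation excludes
    the two opposite caps of height [3 / 5], that is, of radius [4 / 5]. *)
Lemma spread_points (k m N : nat) (v : 'I_k -> 'rV[R]_n) (t : R) :
  (0 < n)%N -> (0 < m)%N -> (forall i, enorm (v i) = 1) ->
  0 <= t -> 2 * t ^+ 2 <= 1 ->
  8 * m%:R * Num.sqrt (1 - t ^+ 2) ^+ n <= 1 ->
  16 * N%:R * (4 / 5) ^+ n <= 1 :> R ->
  (k ^ m < 2 ^ N)%N ->
  exists Y : set 'rV[R]_n,
    [/\ Y `<=` unit_sphere R n,
        forall y z, Y y -> Y z -> y != z -> `|dot y z| <= 3 / 5 &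
        forall c : 'I_m -> 'I_k, exists2 y, Y y & forall j, dot y (v (c j)) < t].
Proof.
move=> n0 m0 v1 t0 t2 mt Nt kN.
have [s s2 good] := @packing_scale R n n0.
have s1 : 1 <= s by lra.
set p := @packing_number R n s in good *.
have [[f fsep] _] := packing_numberP n0 s1; rewrite -/(packing_number s) -/p in f fsep.
have p0 : (0 < p)%N.
  rewrite -(ltr_nat R); apply: lt_le_trans (packing_number_ge n0 s1).
  by rewrite exprn_gt0 // divr_gt0 ?ltr0n //; lra.
have p0R : 0 < p%:R :> R by rewrite ltr0n.
have capP w a a0 a2 w1 := @card_cap_le s _ f w a n0 a0 a2 w1 s2 good fsep.
pose cov (c : {ffun 'I_m -> 'I_k}) : {set 'I_p} :=
  [set i | [exists j, i \in cap f t (v (c j))]]%SET.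
pose conf (x : 'I_p) : {set 'I_p} :=
  [set y | 3 / 5 * (enorm (f x) * enorm (f y)) < `|dot (f y) (f x)| ]%SET.
have [||c|x||X Xsep Xcov] := @greedy_selection _ _ cov conf N.
- by rewrite card_ord.
- by move=> x y; rewrite !inE dotC [enorm (f x) * _]mulrC.
- rewrite card_ord -(ler_nat R) natrM.
  have cov_le : (#|cov c| <= \sum_(j < m) #|cap f t (v (c j))|)%N.
    rewrite -sum1_card big_mkcond /=.
    under [X in (_ <= X)%N]eq_bigr => j _ do rewrite -sum1_card big_mkcond /=.
    rewrite exchange_big; apply: leq_sum => i _.
    rewrite inE; case: existsP => // -[j ij].
    by rewrite (bigD1 j) //= ij.
  have : #|cov c|%:R <= m%:R * (2 * Num.sqrt (1 - t ^+ 2) ^+ n * p%:R) :> R.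
    apply: (@le_trans _ _ (\sum_(j < m) (2 * Num.sqrt (1 - t ^+ 2) ^+ n * p%:R))).
      rewrite -(ler_nat R) natr_sum in cov_le; apply: le_trans cov_le _.
      by apply: ler_sum => j _; exact: (capP _ _ t0 t2 (v1 _)).
    by rewrite sumr_const card_ord [leRHS]mulr_natl.
  move=> h; apply: le_trans (ler_wpM2l _ h) _ => //.
  rewrite [leLHS](_ : _ = (8 * m%:R * Num.sqrt (1 - t ^+ 2) ^+ n) * p%:R); last by ring.
  by rewrite ler_piMl.
- rewrite card_ord -(ler_nat R) !natrM.
  have [fx0|fx0] := eqVneq (f x) 0.
    rewrite (_ : conf x = finset.set0) ?cards0 ?mulr0 //.
    apply/setP => y; rewrite !inE fx0 enorm0 mul0r mulr0.
    by rewrite dot0r normr0 ltxx.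
  have e0 : 0 < enorm (f x) by rewrite enorm_gt0.
  pose w := (enorm (f x))^-1 *: f x.
  have w1 : enorm w = 1 by exact: enorm_normalize.
  have s45 : Num.sqrt (1 - (3 / 5) ^+ 2) = 4 / 5 :> R.
    rewrite (_ : 1 - _ = (4 / 5) ^+ 2) ?sqrtr_sqr; last by field.
    by rewrite ger0_norm //; lra.
  have conf_le : (#|conf x| <= #|cap f (3 / 5) w| + #|cap f (3 / 5) (- w)|)%N.
    apply: leq_trans (leq_card_setU _ _).1; apply: subset_leq_card.
    apply/fintype.subsetP => y; rewrite !inE => yx.
    have : 3 / 5 * enorm (f y) < `|dot (f y) w|.
      rewrite /w dotZr normrM gtr0_norm ?invr_gt0 // [ltRHS]mulrC ltr_pdivlMr //; lra.
    rewrite dotNr; case: (ler0P (dot (f y) w)) => _ /ltW -> //; by rewrite orbT.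
  have c1 := capP w (3 / 5); have c2 := capP (- w) (3 / 5).
  rewrite s45 in c1 c2; rewrite -(ler_nat R) natrD in conf_le.
  have {}c1 := c1 ltac:(lra) ltac:(lra) w1.
  have {}c2 := c2 ltac:(lra) ltac:(lra) ltac:(by rewrite enormN).
  have h : #|conf x|%:R <= 4 * (4 / 5) ^+ n * p%:R :> R by lra.
  have N0 : 0 <= 4 * N%:R :> R by rewrite mulr_ge0.
  apply: le_trans (ler_wpM2l N0 h) _.
  rewrite [leLHS](_ : _ = (16 * N%:R * (4 / 5) ^+ n) * p%:R); last by ring.
  by rewrite ler_piMl.
- by rewrite card_ffun !card_ord.
exists [set (enorm (f i))^-1 *: f i | i in [set i | i \in X /\ f i != 0]].
split.
- by move=> _ [i [_ fi0] <-]; exact: enorm_normalize.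
- move=> _ _ [i [iX fi0] <-] [j [jX fj0] <-] ij.
  have {}ij : i != j by apply: contraNneq ij => ->.
  have := Xsep _ _ iX jX ij; rewrite inE -leNgt => h.
  have ei : 0 < enorm (f i) by rewrite enorm_gt0.
  have ej : 0 < enorm (f j) by rewrite enorm_gt0.
  rewrite dotZl dotZr mulrA -invfM normrM gtr0_norm ?invr_gt0 ?mulr_gt0 //.
  by rewrite mulrC ler_pdivrMr ?mulr_gt0 // [enorm (f i) * _]mulrC.
- move=> c; have [i iX] := Xcov [ffun j => c j].
  rewrite inE negb_exists => /forallP ic.
  have {}ic (j : 'I_m) : dot (f i) (v (c j)) < t * enorm (f i).
    by have := ic j; rewrite ffunE inE -ltNge.
  have fi0 : f i != 0.
    apply/eqP => fi0; have := ic (Ordinal m0).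
    by rewrite fi0 enorm0 mulr0 dot0l ltxx.
  have ei : 0 < enorm (f i) by rewrite enorm_gt0.
  exists ((enorm (f i))^-1 *: f i); first by exists i.
  by move=> j; rewrite dotZl mulrC ltr_pdivrMr.
Qed.

End Caps.

(** * Exponential estimates *)

Section Bernoulli.
Context {R : realFieldType}.
Implicit Types (h x : R).

Lemma bernoulli h n : -1 <= h -> 1 + n%:R * h <= (1 + h) ^+ n.
Proof.
move=> h1; elim: n => [|n IH]; first by rewrite mul0r addr0.
rewrite exprS -natr1; have n0 : 0 <= n%:R :> R by [].
have h2 : 0 <= 1 + h by lra.
have := ler_wpM2l h2 IH; have := mulr_ge0 n0 (sqr_ge0 h); lra.
Qed.

(** With [x = 1 / (2 n)], use [(1 - x) ^+ n >= 1 / 2] and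
    [(1 - x) (1 + x) <= 1]. *)
Lemma exprn_1Dinv_le2 n : (1 + (2 * n%:R)^-1) ^+ n <= 2 :> R.
Proof.
case: n => [|n]; first by rewrite expr0; lra.
set x := _^-1.
have n1 : 1 <= n.+1%:R :> R by rewrite ler1n.
have nx : n.+1%:R * x = 2^-1 by rewrite /x; field; apply: lt0r_neq0; lra.
have x0 : 0 < x by rewrite invr_gt0; lra.
have x1 : x <= 1 by nra.
have h1 : 2^-1 <= (1 - x) ^+ n.+1.
  have hx : -1 <= - x by lra.
  by have := bernoulli n.+1 hx; rewrite mulrN nx; lra.
have h2 : (1 - x) ^+ n.+1 * (1 + x) ^+ n.+1 <= 1.
  by rewrite -exprMn; apply: exprn_ile1; nra.
have : 0 <= (1 + x) ^+ n.+1 by apply: exprn_ge0; lra.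
nra.
Qed.
End Bernoulli.

(** By Bernoulli's inequality [(1 + h) ^+ (4 n) >= (h n) ^+ 4], and the fourth
    power leaves a factor [n ^+ 2] to absorb [A]. *)
Lemma sqr_mul_exprn_le1 {R : realType} (A h x : R) :
  0 < h -> 0 <= x -> (1 + h) ^+ 4 * x <= 1 ->
  exists n0 : nat, forall n : nat, (n0 <= n)%N -> A * n%:R ^+ 2 * x ^+ n <= 1.
Proof.
move=> h0 x0 hx; exists (Num.truncn (A / h ^+ 4)).+1 => n nn0.
have n1 : 1 <= n%:R :> R by rewrite ler1n; lia.
have h40 : 0 < h ^+ 4 by rewrite exprn_gt0.
have An : A <= h ^+ 4 * n%:R ^+ 2.
  have : A / h ^+ 4 < n%:R.
    by apply: lt_le_trans (truncnS_gt _) _; rewrite ler_nat.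
  rewrite ltr_pdivrMr // => An; apply: (le_trans (ltW An)).
  by rewrite mulrC ler_pM2l // expr2 ler_peMl //; lra.
have xn0 : 0 <= x ^+ n by rewrite exprn_ge0.
have n20 : 0 <= n%:R ^+ 2 :> R by rewrite exprn_ge0.
apply: le_trans (_ : (h * n%:R) ^+ 4 * x ^+ n <= 1).
  apply: ler_wpM2r => //; apply: le_trans (ler_wpM2r n20 An) _.
  by rewrite le_eqVlt; apply/orP; left; apply/eqP; ring.
apply: le_trans (_ : ((1 + h) ^+ n) ^+ 4 * x ^+ n <= 1).
  apply: ler_wpM2r => //; apply: lerXn2r; rewrite ?nnegrE.
  - by rewrite mulr_ge0 //; lra.
  - by rewrite exprn_ge0 //; lra.
  - have h1 : -1 <= h by lra.
    by have := bernoulli n h1; rewrite mulrC; lra.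
rewrite exprAC -exprMn; apply: exprn_ile1 => //.
by rewrite mulr_ge0 // exprn_ge0; lra.
Qed.


(** Enlarging the caps to allow for the mesh [d] of the net costs only a constant
    factor, because [d] is of order [1 / n]: the squared radius grows from
    [D ^- 2] to at most [D ^- 2 * (1 + 1 / (2 n))]. *)
Lemma cap_radius_exprn {R : realType} (D t d : R) (n : nat) :
  (0 < n)%N -> 1 < D -> D < 1116%:R / 1000%:R -> t ^+ 2 = 1 - D^-1 ^+ 2 -> 0 <= t ->
  d = (4 * n%:R)^-1 ->
  Num.sqrt (1 - (t - d) ^+ 2) ^+ n * D ^+ n <= 2.
Proof.
move=> n0 D1 D2 tD t0 dE.
have n1 : 1 <= n%:R :> R by rewrite ler1n.
have D0 : 0 < D by lra.
have DV : D^-1 * D = 1 by rewrite mulVf ?gt_eqF.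
have DV0 : 0 < D^-1 by rewrite invr_gt0.
have DV1 : D^-1 < 1 by rewrite invf_lt1.
have DV2 : 8 / 10 <= D^-1 ^+ 2 by nra.
have d0 : 0 < d by rewrite dE invr_gt0; lra.
have dn : d * n%:R = 4^-1 by rewrite dE; field; apply: lt0r_neq0; lra.
have d1 : d <= 4^-1 by nra.
have tle : t <= D^-1 ^+ 2 by nra.
have td1 : (t - d) ^+ 2 <= 1 by nra.
have dE2 : (2 * n%:R)^-1 = 2 * d by rewrite dE; field; apply: lt0r_neq0; lra.
have rho2 : (1 - (t - d) ^+ 2) * D ^+ 2 <= 1 + (2 * n%:R)^-1.
  have : 1 - (t - d) ^+ 2 <= D^-1 ^+ 2 * (1 + 2 * d) by nra.
  move=> /(ler_wpM2r (sqr_ge0 D)) /le_trans; apply.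
  by rewrite mulrAC -exprMn DV expr1n mul1r dE2.
have rho0 : 0 <= (1 - (t - d) ^+ 2) * D ^+ 2 by rewrite mulr_ge0 ?sqr_ge0 ?subr_ge0.
have rhon := lerXn2r n rho0 (le_trans rho0 rho2) rho2.
have := le_trans rhon (exprn_1Dinv_le2 n).
have a0 : 0 <= Num.sqrt (1 - (t - d) ^+ 2) ^+ n * D ^+ n.
  by rewrite mulr_ge0 ?exprn_ge0 ?sqrtr_ge0 // ltW.
rewrite -{1}(@sqr_sqrtr _ (1 - (t - d) ^+ 2)) ?subr_ge0 //.
rewrite -exprMn -!exprM mulnC exprM exprMn => h; nra.
Qed.

Lemma net_count (k m n : nat) :
  (0 < n)%N -> (0 < m)%N -> (k <= (20 * n ^ 2) ^ n)%N ->
  exists N, (k ^ m < 2 ^ N)%N /\ (N <= 8 * n ^ 2 * m)%N.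
Proof.
move=> n0 m0 kn; exists ((2 * n + 5) * n * m).+1; split; last first.
  nia.
apply: leq_ltn_trans (_ : 2 ^ ((2 * n + 5) * n * m) < _)%N; last first.
  by rewrite ltn_exp2l.
rewrite expnM leq_exp2r // (leq_trans kn) // expnM leq_exp2r //.
rewrite expnD mulnC [(2 * n)%N]mulnC expnM.
apply: leq_mul => //; by rewrite leq_exp2r // ltnW // ltn_expl.
Qed.

(** * Bodies with a large illumination number *)

(** Selecting [N], of order [n ^+ 2 * D ^+ n], points defeats all [m]-tuples of
    caps centred in a net of mesh [d = 1 / (4 n)] and of height [t - d], hence all
    [m]-tuples of caps of height [t].  The separation condition requires
    [16 * N * (4 / 5) ^+ n <= 1], which holds for large [n] as
    [4 / 5 * D < 0.893]. *)
Lemma poorly_illuminated_points {R : realType} (D : R) :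
  1 < D -> D < 1116%:R / 1000%:R ->
  exists n0 : nat, forall n : nat, (n0 <= n)%N -> (0 < n)%N /\
    exists Y : set 'rV[R]_n,
      [/\ Y `<=` unit_sphere R n, Y !=set0,
          forall y z, Y y -> Y z -> y != z -> `|dot y z| <= 3 / 5 &
          forall (k : nat) (w : 'I_k -> 'rV[R]_n),
            k%:R <= 5%:R / 100%:R * D ^+ n -> (forall i, enorm (w i) = 1) ->
            exists2 y, Y y & forall i, dot y (w i) < Num.sqrt (1 - D^-1 ^+ 2)].
Proof.
move=> D1 D2.
have D0 : 0 < D by lra.
have DV : D^-1 * D = 1 by rewrite mulVf ?gt_eqF.
have DV0 : 0 < D^-1 by rewrite invr_gt0.
have DV1 : D^-1 < 1 by rewrite invf_lt1.
have DV2 : 8 / 10 <= D^-1 ^+ 2 by nra.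
set t := Num.sqrt (1 - D^-1 ^+ 2).
have t2 : t ^+ 2 = 1 - D^-1 ^+ 2 by rewrite sqr_sqrtr //; nra.
have t0 : 0 < t by rewrite sqrtr_gt0; nra.
(* [1.028 ^+ 4 * (4 / 5) * 1.116 < 1]; the factor [32 / 5] is
   [16 * 8 * 0.05]. *)
have [|||n1 hn1] := @sqr_mul_exprn_le1 R (32 / 5) (28 / 1000) (4 / 5 * D).
- lra.
- lra.
- lra.
(* [n2] ensures [20 <= D ^+ n], hence [0 < m]; [n3] ensures [d <= t]. *)
pose n2 := (Num.truncn (20 / (D - 1))).+1.
pose n3 := (Num.truncn (4 * t)^-1).+1.
exists (maxn n1 (maxn n2 n3)) => n; rewrite !geq_max => /and3P[nn1 nn2 nn3].
have n0 : (0 < n)%N by rewrite (leq_trans _ nn2).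
split=> //.
have nR : 0 < n%:R :> R by rewrite ltr0n.
pose d : R := (4 * n%:R)^-1.
have d0 : 0 < d by rewrite invr_gt0; lra.
have n1R : 1 <= n%:R :> R by rewrite ler1n.
have d1 : d <= 1 by rewrite invf_le1 ?mulr_gt0 //; lra.
have dt : d <= t.
  have : (4 * t)^-1 <= n%:R.
    by apply: le_trans (ltW (truncnS_gt _)) _; rewrite ler_nat.
  rewrite -[X in X <= _]mul1r ler_pdivrMr ?mulr_gt0 // => h.
  by rewrite /d -[X in X <= _]mul1r ler_pdivrMr ?mulr_gt0 //; lra.
pose m := Num.truncn (5%:R / 100%:R * D ^+ n).
have Dn0 : 0 < D ^+ n by rewrite exprn_gt0.
have mD : m%:R <= 5%:R / 100%:R * D ^+ n by rewrite truncn_le mulr_ge0 // ltW.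
have m0 : (0 < m)%N.
  rewrite truncn_gt0.
  have h1 : -1 <= D - 1 by lra.
  have := bernoulli n h1; rewrite (_ : 1 + (D - 1) = D) => [h2|]; last by ring.
  have : 20 / (D - 1) <= n%:R.
    by apply: le_trans (ltW (truncnS_gt _)) _; rewrite ler_nat.
  rewrite ler_pdivrMr ?subr_gt0 //; lra.
have [k [v [v1 vnet vk]]] := @sphere_net R n d n0 d0 d1.
have kn : (k <= (20 * n ^ 2) ^ n)%N.
  rewrite -(ler_nat R) natrX natrM natrX; apply: le_trans vk _.
  rewrite le_eqVlt; apply/orP; left; apply/eqP; congr (_ ^+ _).
  by rewrite /d invrK; ring.
have [N [kN Nm]] := net_count n0 m0 kn.
have rD := cap_radius_exprn n0 D1 D2 t2 (ltW t0) (erefl d).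
have rn0 : 0 <= Num.sqrt (1 - (t - d) ^+ 2) ^+ n by rewrite exprn_ge0 ?sqrtr_ge0.
have [||||Y [Y1 Ysep Yhard]] := @spread_points R n k m N v (t - d) n0 m0 v1 _ _ _ _ kN.
- by rewrite subr_ge0.
- nra.
- apply: (@le_trans _ _
    (8 * (5%:R / 100%:R * D ^+ n) * Num.sqrt (1 - (t - d) ^+ 2) ^+ n)).
    by apply: ler_wpM2r => //; lra.
  lra.
- have := hn1 n nn1; rewrite exprMn => h.
  have x0 : 0 < (4 / 5) ^+ n :> R by rewrite exprn_gt0.
  have NR : N%:R <= 8 * n%:R ^+ 2 * (5%:R / 100%:R * D ^+ n).
    apply: (@le_trans _ _ (8 * n%:R ^+ 2 * m%:R)).
      by rewrite -natrX -!natrM ler_nat.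
    by apply: ler_wpM2l => //; rewrite mulr_ge0 ?sqr_ge0.
  have := ler_wpM2r (ltW x0) NR; lra.
have hard (w : 'I_m -> 'rV[R]_n) : (forall i, enorm (w i) = 1) ->
    exists2 y, Y y & forall i, dot y (w i) < t.
  move=> w1; have [c wc] := choice (fun i => vnet _ (w1 i)).
  have [y Yy yc] := Yhard c; exists y => // i.
  have := dot_le y (w i - v (c i)); have := yc i; have := wc i.
  rewrite (Y1 _ Yy) mul1r dotDr dotNr; lra.
pose e : 'rV[R]_n := delta_mx ord0 (Ordinal n0).
have e1 : enorm e = 1.
  apply: enorm_eq => //; rewrite expr1n /dot (bigD1 (Ordinal n0)) //= big1.
    by rewrite !mxE !eqxx mulr1 addr0.
  by move=> i ni; rewrite !mxE eqxx (negbTE ni) mulr0.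
exists Y; split=> //.
  by have [y Yy _] := hard (fun=> e) (fun=> e1); exists y.
move=> k' w k'D w1.
have k'm : (k' <= m)%N by rewrite truncn_ge_nat // mulr_ge0 // ltW.
(* Fewer than [m] directions are padded with [e]. *)
pose w' (j : 'I_m) := if insub (j : nat) is Some i then w i else e.
have [|y Yy yw] := hard w'; first by move=> j; rewrite /w'; case: insub.
exists y => // i; have := yw (widen_ord k'm i); rewrite /w' /=.
rewrite (insubT (fun j => j < k')%N (ltn_ord i)) /=.
by rewrite (_ : Sub _ _ = i) //; exact: val_inj.
Qed.

Theorem theorem1p1 (R : realType) (D : R) (hD1 : 1 < D)
    (hD2 : D < 1116%:R / 1000%:R) :
  exists n0 : nat, forall n : nat, (n0 <= n)%N ->
    exists K : set 'rV[R]_n,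
      [/\ convex_body K,
          o_symmetric K,
          illumination_number K = covering_number K (interior K),
          ((5%:R / 100%:R * D ^+ n)%:E <= illumination_number K)%E &
          [set D^-1 *: x | x in unit_ball R n] `<=` K /\ K `<=` unit_ball R n].
Proof.
have [n0 hn0] := poorly_illuminated_points hD1 hD2.
exists n0 => n /hn0 [n_gt0 [Y [Y1 [y0 Yy0] Ysep Yhard]]] {hn0}.
have D0 : 0 < D by lra.
have DV : D^-1 * D = 1 by rewrite mulVf ?gt_eqF.
have DV0 : 0 < D^-1 by rewrite invr_gt0.
have DV1 : D^-1 < 1 by rewrite invf_lt1.
have DV2 : 8 / 10 <= D^-1 ^+ 2 by nra.
set t := Num.sqrt (1 - D^-1 ^+ 2) in Yhard.
have t2 : t ^+ 2 = 1 - D^-1 ^+ 2 by rewrite sqr_sqrtr //; nra.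
have t0 : 0 <= t by rewrite sqrtr_ge0.
have t1 : t < 1 by nra.
pose K := spiky_body t Y; exists K.
have KB : K `<=` unit_ball R n by move=> y [].
have bK y : Y y -> boundary K y.
  move=> Yy; apply: unit_boundary KB _ (Y1 _ Yy).
  apply: spike_in_spiky_body => //; first exact: ltW.
  by move=> x z Yx Yz xz; apply: le_trans (Ysep _ _ Yx Yz xz) _; lra.
have Kbody : convex_body K by exact: spiky_body_convex_body.
split=> //.
- exact: spiky_body_symmetric.
- by apply: illumination_eq_covering => //; exists y0; exact: bK.
- apply: le_ereal_inf_tmp => _ [k [U Uk [U1 HU]] <-].
  rewrite lee_fin leNgt; apply/negP => kD.
  have /card_esym/card_set_bijP[g [gfun ginj gsurj]] := Uk.
  have [|y Yy yU] := Yhard k (fun i : 'I_k => - g i) (ltW kD).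
    by move=> i; rewrite enormN; apply/U1/gfun => /=.
  have [u Uu uy] := HU y (bK y Yy).
  have [i ik ui] := gsurj u Uu.
  have := illuminates_spike Y1 Yy (U1 _ Uu) uy.
  by rewrite leNgt -ui (yU (Ordinal ik)).
- split=> // _ [x x1 <-]; apply: ball_sub_spiky_body => //.
  have x2 : dot x x <= 1.
    by rewrite -sqr_enorm; apply: exprn_ile1; rewrite ?enorm_ge0.
  by rewrite dotZl dotZr mulrA -expr2 t2 subKr ler_piMr ?sqr_ge0.
Qed.
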